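(* Let $G\subset \mathrm{GL}(V)$ be a finite complex reflection group on $V$, $\dim_{\mathbb C}V=n$, with degrees $d_1\ge\dots\ge d_n$, such that $\mathfrak a(d_1)=\mathfrak b(d_1)$. Let $(g,\zeta,q)$ be an admissible triplet of $G$, let $\delta>1$ be a divisor of $d_1$, and put $E=V(g^{d_1/\delta},\zeta^{d_1/\delta})$ (the $\zeta^{d_1/\delta}$-eigenspace of $g^{d_1/\delta}$ in $V$) and $G_\delta=\pi_E(N_E)\subset \mathrm{GL}(E)$. Then the following hold. (1) If $z=(z_1,\ldots,z_n)$ is a $(g,\zeta)$-graded coordinate system of $V$, then $\phi_E(z_\alpha)=0$ on $E$ for all $\alpha\in\mathfrak i^c(\delta)$. Moreover $\phi_E(z_\alpha)$ $(\alpha\in\mathfrak i(\delta))$ form a $(\pi_E(g),\zeta)$-graded coordinate system of $E$. In other words, the ring homomorphism $\phi_E:S[V]\to S[E]$ is given by the quotient map $$S[V]\cong\mathbb C[z_1,\ldots,z_n]\longrightarrow S[E]\cong \mathbb C[z_1,\ldots,z_n]/(z_\alpha\mid\alpha\in\mathfrak i^c(\delta)).$$ (2) If a set $x=(x_1,\ldots,x_n)$ of basic invariants of $G$ is compatible at $q$ with a $(g,\zeta)$-graded coordinate system $z$ of $V$, then the set of basic invariants $\phi_E(x_\alpha)$ $(\alpha\in\mathfrak i(\delta))$ of $G_\delta$ is compatible at $q$ with $\phi_E(z_\alpha)$ $(\alpha\in\mathfrak i(\delta))$. (3) If a set $x=(x_1,\ldots,x_n)$ of basic invariants of $G$ is good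 with respect to $(g,\zeta,q)$, then the set of basic invariants $\phi_E(x_\alpha)$ $(\alpha\in\mathfrak i(\delta))$ of $G_\delta$ is good with respect to $(\pi_E(g),\zeta,q)$.
   Context: Reflection groups. A reflection on a complex vector space $V$ is a linear transformation of finite order which fixes a hyperplane pointwise (and is not the identity). A finite complex reflection group is a finite subgroup $G\subset\mathrm{GL}(V)$ generated by reflections. $S[V]$ denotes the ring of polynomial functions on $V$. The ring of $G$-invariants $S[V]^G$ is generated by $n=\dim V$ algebraically independent homogeneous polynomials $x_1,\ldots,x_n$; such a set is called a set of basic invariants, and the degrees of $G$ are $d_\alpha=\deg x_\alpha$, ordered so that $d_1\ge\dots\ge d_n$. The codegrees $d_1^*(=0)\le\dots\le d_n^*$ of $G$ are the integers such that the free $S[V]^G$-module of $G$-invariant polynomial derivations of $S[V]$ has a homogeneous basis whose elements have coefficients of polynomial degrees $d_1^*+1,\ldots,d_n^*+1$. Notation. For a positive integer $d$: $\mathfrak a(d)=\#\{\alpha\mid d \text{ divides } d_\alpha\}$, $\mathfrak b(d)=\#\{\alpha\mid d\text{ divides }d_\alpha^*\}$, $\mathfrak i(d)=\{\alpha\in\{1,\ldots,n\}\mid d\text{ divides }d_\alpha\}$, $\mathfrak i^c(d)=\{1,\ldots,n\}\setminus\mathfrak i(d)$. For $h\in \mathrm{GL}(V)$ and $\xi\in\mathbb C$, $V(h,\xi)$ is the $\xi$-eigenspace of $h$ in $V$. Regularity and admissible triplets. A vector $q\in V$ is regular if it lies on no reflection hyperplane of $G$. An element $g\in G$ is $\zeta$-regular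 if $V(g,\zeta)$ contains a regular vector. An admissible triplet of $G$ is a triple $(g,\zeta,q)$ where $\zeta$ is a primitive $d_1$-th root of unity ($d_1$ the largest degree), $g\in G$ is $\zeta$-regular, and $q$ is a regular vector with $gq=\zeta q$. (Such a triplet exists if and only if $\mathfrak a(d_1)=\mathfrak b(d_1)$; the eigenvalues of $g$ on $V$ are then $\zeta^{1-d_\alpha}$, $1\le\alpha\le n$.) Graded coordinates. A linear coordinate system $z=(z_1,\ldots,z_n)$ of $V$ is $(g,\zeta)$-graded if $g^*z_\alpha=\zeta^{d_\alpha-1}z_\alpha$ for $1\le\alpha\le n$, where $g^*f=f\circ g^{-1}$ (i.e. the basis $q_1,\ldots,q_n$ of $V$ dual to $z$ satisfies $gq_\alpha=\zeta^{1-d_\alpha}q_\alpha$). Compatibility. A set of basic invariants $x=(x_1,\ldots,x_n)$ is compatible at $q$ with a $(g,\zeta)$-graded coordinate system $z$ if $\frac{\partial x_\alpha}{\partial z_\beta}(q)=1$ when $\alpha=\beta$ and $0$ when $\alpha\ne\beta$ $(1\le\alpha,\beta\le n)$. Good basic invariants. Put $I_\alpha^{(0)}=\{(a_1,\ldots,a_n)\in\mathbb Z_{\ge0}^n\mid a_1d_1+\cdots+a_nd_n=d_\alpha,\ a_1+\cdots+a_n\ge2\}$. A set of basic invariants $x$ is good with respect to the admissible triplet $(g,\zeta,q)$ if $$\frac{\partial^{a_1+\cdots+a_n}x_\alpha}{\partial z_1^{a_1}\cdots\partial z_n^{a_n}}(q)=0\qquad(1\le\alpha\le n,\ (a_1,\ldots,a_n)\in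 I_\alpha^{(0)}),$$ where $z$ is a $(g,\zeta)$-graded coordinate system of $V$ (the condition does not depend on the choice of $z$). Reflection subquotient. For a subspace $E\subset V$, $N_E=\{s\in G\mid s(E)\subset E\}$, $\pi_E:N_E\to\mathrm{GL}(E)$ is the restriction map $s\mapsto s|_E$, and $\phi_E:S[V]\to S[E]$ is the surjective ring homomorphism given by restricting polynomial functions to $E$. For $E=V(g^{d_1/\delta},\zeta^{d_1/\delta})$ as in the claim, it is known that $G_\delta=\pi_E(N_E)$ is a finite complex reflection group on $E$ with degrees $d_\alpha$ $(\alpha\in\mathfrak i(\delta))$, so its highest degree is $d_1$; that for any set $x$ of basic invariants of $G$ the $\phi_E(x_\alpha)$ $(\alpha\in\mathfrak i(\delta))$ form a set of basic invariants of $G_\delta$ and $\phi_E(x_\alpha)=0$ for $\alpha\in\mathfrak i^c(\delta)$; that $q\in E$ and $g\in N_E$; and that $(\pi_E(g),\zeta,q)$ is an admissible triplet of $G_\delta$. The notions graded, compatible and good for $G_\delta$ are those above, applied to $G_\delta$ acting on $E$, with coordinates and invariants indexed by $\alpha\in\mathfrak i(\delta)$ and with degrees $d_\alpha$ $(\alpha\in\mathfrak i(\delta))$. *)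

(* Defs.v *)
From HB Require Import structures.
From mathcomp Require Import all_boot all_order all_algebra.
From mathcomp Require Import finmap mpoly.
From mathcomp Require Import boolp classical_sets functions reals.
From mathcomp Require Import complex.

Set Implicit Arguments.
Unset Strict Implicit.
Unset Printing Implicit Defensive.

Import Order.TTheory GRing.Theory Num.Theory.

Local Open Scope fset_scope.
Local Open Scope ring_scope.

Section PolynomialFunctions.
Variables (C : numFieldType) (V : vectType C).

Definition stdcoord (v : V) : 'I_(\dim {:V}) -> C :=
  fun i => coord (vbasis {:V}) i v.

(* Any other basis would give the same set of functions. *)
Definition is_polyfun (f : V -> C^o) : bool :=
  `[< exists p : {mpoly C[\dim {:V}]}, forall v, f v = p.@[stdcoord v] >].

Lemma is_polyfun_subring : subring_closed is_polyfun.
Proof.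
split.
- by apply/asboolP; exists 1 => v; rewrite meval1.
- move=> f h /asboolP[p fp] /asboolP[q hq]; apply/asboolP; exists (p - q) => v.
  by rewrite mevalB -fp -hq.
- move=> f h /asboolP[p fp] /asboolP[q hq]; apply/asboolP; exists (p * q) => v.
  by rewrite mevalM -fp -hq.
Qed.

HB.instance Definition _ :=
  GRing.isSubringClosed.Build (V -> C^o) is_polyfun is_polyfun_subring.

Lemma is_polyfun_scale : GRing.scaler_closed is_polyfun.
Proof.
move=> c f /asboolP[p fp]; apply/asboolP; exists (c *: p) => v.
by rewrite mevalZ -fp.
Qed.

HB.instance Definition _ :=
  GRing.isScaleClosed.Build C (V -> C^o) is_polyfun is_polyfun_scale.

(* S[V] *)
Record polyfun := Polyfun {pf_fun :> V -> C^o; pf_prop : is_polyfun pf_fun}.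

HB.instance Definition _ := [isSub for pf_fun].
HB.instance Definition _ := [Choice of polyfun by <:].
HB.instance Definition _ := 
  GRing.SubChoice_isSubComPzRing.Build _ _ polyfun (subringClosedP _).

Lemma polyfun_nonzero : (1 : polyfun) != 0.
Proof.
apply/eqP => /(congr1 (fun f : polyfun => (f : V -> C^o) 0)) /eqP.
exact/negP/oner_neq0.
Qed.

HB.instance Definition _ :=
  GRing.PzSemiRing_isNonZero.Build polyfun polyfun_nonzero.
HB.instance Definition _ := [SubZmodule_isSubLmodule of polyfun by <:].

Lemma polyfun_scalerAl (c : C) (f h : polyfun) : c *: (f * h) = c *: f * h.
Proof. by apply/val_inj/funext => v /=; exact: mulrA. Qed.

HB.instance Definition _ :=
  GRing.Lmodule_isLalgebra.Build C polyfun polyfun_scalerAl.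
HB.instance Definition _ := GRing.Lalgebra_isComAlgebra.Build C polyfun.

End PolynomialFunctions.

Section Pullback.
Variables (C : numFieldType) (U V : vectType C) (L : 'Hom(U, V)).

Lemma is_polyfun_comp (f : polyfun V) : is_polyfun ((f : V -> C^o) \o L).
Proof.
case: f => f /= /asboolP[p fp]; apply/asboolP.
pose M := (fun i : 'I_(\dim {:V}) => \sum_(j < \dim {:U})
   coord (vbasis {:V}) i (L (vbasis {:U})`_j) *: 'X_j) : 'I__ -> {mpoly C[_]}.
exists (p \mPo [tuple M i | i < _]) => u /=; rewrite fp comp_mpoly_meval.
apply: meval_eq => i; rewrite !tnth_mktuple /M raddf_sum /stdcoord /=.
rewrite {1}(coord_vbasis (memvf u)) !linear_sum /=.
by apply: eq_bigr => j _; rewrite !linearZ /= mevalXU mulrC.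
Qed.

Definition pullback (f : polyfun V) : polyfun U := Polyfun (is_polyfun_comp f).

Lemma pullback_is_linear : linear pullback.
Proof. by move=> c f h; apply/val_inj/funext. Qed.

HB.instance Definition _ :=
  GRing.isLinear.Build C (polyfun V) (polyfun U) _ pullback pullback_is_linear.

Lemma pullback_is_monoid_morphism : monoid_morphism pullback.
Proof. by split=> [|f h]; apply/val_inj/funext. Qed.

HB.instance Definition _ := GRing.isMonoidMorphism.Build
  (polyfun V) (polyfun U) pullback pullback_is_monoid_morphism.

End Pullback.

Section Coordinates.
Variables (C : numFieldType) (V : vectType C).

Definition homog_polyfun (k : nat) (f : polyfun V) : Prop :=
  exists2 p : {mpoly C[\dim {:V}]},
    p \is k.-homog & forall v, f v = p.@[stdcoord v].

Variable I : finType.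

(* P(y): families are indexed by a finite type I, and the variables of P, in
   'I_#|I|, are matched with I by its enumeration. *)
Definition subst (y : I -> polyfun V) (P : {mpoly C[#|I|]}) : polyfun V :=
  mmap (in_alg (polyfun V)) (fun i => y (enum_val i)) P.

Lemma subst_is_linear y : linear (subst y).
Proof.
move=> c p q; rewrite /subst raddfD /=; congr (_ + _).
by rewrite -mul_mpolyC rmorphM /= mmapC mulr_algl.
Qed.

HB.instance Definition _ y := GRing.isLinear.Build C {mpoly C[#|I|]}
  (polyfun V) _ (subst y) (subst_is_linear y).

Lemma subst_is_monoid_morphism y : monoid_morphism (subst y).
Proof. by split=> [|p q]; rewrite /subst ?rmorph1 ?rmorphM. Qed.

HB.instance Definition _ y := GRing.isMonoidMorphism.Build {mpoly C[#|I|]}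
  (polyfun V) (subst y) (subst_is_monoid_morphism y).

Definition mono (a : I -> nat) : 'X_{1..#|I|} :=
  [multinom a (enum_val i) | i < #|I|].

Definition linear_coordinates (z : I -> polyfun V) : Prop :=
  (forall al, scalar (z al : V -> C)) /\
  bijective (fun v => [ffun al => z al v : C]).

(* The unique expression of f as a polynomial in z, when z is a system of
   linear coordinates; 0 by default. *)
Definition expand (z : I -> polyfun V) (f : polyfun V) : {mpoly C[#|I|]} :=
  xget 0 [set P | subst z P = f]%classic.

(* The partial derivative of f of multi-order a in the coordinates z. *)
Definition pderiv (z : I -> polyfun V) (a : I -> nat) (f : polyfun V) :
    polyfun V :=
  subst z (mderivm (mono a) (expand z f)).

End Coordinates.

Section ReflectionGroups.
Variables (C : numFieldType) (V : vectType C).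
Implicit Types (G : {fset 'End(V)}) (g s : 'End(V)).

Definition lpow g (k : nat) : 'End(V) := iter k (comp_lfun g) \1%VF.

Definition finite_subgroup_GL G : Prop :=
  [/\ forall g, g \in G -> lker g = 0%VS,
      \1%VF \in G,
      forall g h, g \in G -> h \in G -> (g \o h)%VF \in G
    & forall g, g \in G -> (g^-1)%VF \in G].

Definition reflection s : Prop :=
  [/\ s != \1%VF,
      exists2 m, (0 < m)%N & lpow s m = \1%VF
    & exists2 H : {vspace V},
        (\dim H).+1 = \dim {:V} & (H <= fixedSpace s)%VS].

Definition reflection_group G : Prop :=
  finite_subgroup_GL G /\
  forall K : {fset 'End(V)}, finite_subgroup_GL K ->
    (forall s, s \in G -> reflection s -> s \in K) -> G `<=` K.

(* g^* f = f \o g^-1 *)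
Definition act g : polyfun V -> polyfun V := pullback (g^-1)%VF.

Definition invariant G (f : polyfun V) : Prop := forall g, g \in G -> act g f = f.

Definition homog_invariants G (I : finType) (d : I -> nat)
    (x : I -> polyfun V) : Prop :=
  forall al, homog_polyfun (d al) (x al) /\ invariant G (x al).

Definition basic_invariants G (I : finType) (d : I -> nat)
    (x : I -> polyfun V) : Prop :=
  [/\ #|I| = \dim {:V},
      homog_invariants G d x,
      injective (subst x)
    & forall f, invariant G f -> exists P, f = subst x P].

Definition degrees G (n : nat) (d : 'I_n -> nat) : Prop :=
  (forall i j : 'I_n, (i <= j)%N -> (d j <= d i)%N) /\
  exists x, basic_invariants G d x.

Definition derivation (D : polyfun V -> polyfun V) : Prop :=
  linear D /\ forall f h, D (f * h) = D f * h + f * D h.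

Definition invariant_derivation G (D : polyfun V -> polyfun V) : Prop :=
  derivation D /\ forall g f, g \in G -> D (act g f) = act g (D f).

(* The coefficients of D in a coordinate system z are the D (z al). *)
Definition homog_derivation (k : nat) (D : polyfun V -> polyfun V) : Prop :=
  forall l : polyfun V, scalar (l : V -> C) -> homog_polyfun k (D l).

Definition invariant_derivation_basis G (I : finType)
    (D : I -> polyfun V -> polyfun V) : Prop :=
  (forall al, invariant_derivation G (D al)) /\
  forall D', invariant_derivation G D' ->
    exists! h : {ffun I -> polyfun V},
      (forall al, invariant G (h al)) /\
      (forall f, D' f = \sum_al h al * D al f).

(* Codegrees are integers: a G with nonzero invariant vectors has codegrees
   equal to -1; for the other groups the first codegree is 0. *)
Definition codegrees G (n : nat) (ds : 'I_n -> int) : Prop :=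
  (forall i j : 'I_n, (i <= j)%N -> ds i <= ds j) /\
  exists D, invariant_derivation_basis G D /\
    forall al, exists2 k : nat, k%:Z = ds al + 1 & homog_derivation k (D al).

Definition regular G (q : V) : Prop :=
  forall s, s \in G -> reflection s -> q \notin fixedSpace s.

Definition regular_element G g (zeta : C) : Prop :=
  g \in G /\ exists2 v, v \in passmx.leigenspace g zeta & regular G v.

Definition admissible G (d1 : nat) g (zeta : C) (q : V) : Prop :=
  [/\ d1.-primitive_root zeta, regular_element G g zeta,
      regular G q & g q = zeta *: q].

End ReflectionGroups.

Section GoodInvariants.
Variables (C : numFieldType) (V : vectType C) (I : finType) (d : I -> nat).

Definition graded (g : 'End(V)) (zeta : C) (z : I -> polyfun V) : Prop :=
  linear_coordinates z /\
  forall al, act g (z al) = zeta ^+ (d al - 1) *: z al.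

Definition compatible (z : I -> polyfun V) (q : V) (x : I -> polyfun V) : Prop :=
  forall al be,
    pderiv z (fun ga => (ga == be) : nat) (x al) q = (al == be)%:R :> C.

(* The condition does not depend on the graded coordinates z. *)
Definition good (g : 'End(V)) (zeta : C) (q : V) (x : I -> polyfun V) : Prop :=
  exists2 z, graded g zeta z &
    forall (al : I) (a : I -> nat),
      (\sum_be a be * d be = d al)%N -> (2 <= \sum_be a be)%N ->
      pderiv z a (x al) q = 0 :> C.

End GoodInvariants.

Section Subquotient.
Variables (C : numFieldType) (V : vectType C) (E : {vspace V}).

Definition phi : polyfun V -> polyfun (subvs_of E) :=
  pullback (linfun (@vsval _ _ E)).

HB.instance Definition _ := GRing.Linear.on phi.
HB.instance Definition _ := GRing.RMorphism.on phi.

(* The restriction s|_E when s(E) is contained in E. *)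
Definition restr (s : 'End(V)) : 'End(subvs_of E) :=
  (linfun (vsproj E) \o s \o linfun (@vsval _ _ E))%VF.

Definition stab (G : {fset 'End(V)}) : {fset 'End(V)} :=
  [fset s in G | (s @: E <= E)%VS].

Definition subquotient (G : {fset 'End(V)}) : {fset 'End(subvs_of E)} :=
  [fset restr s | s in stab G].

End Subquotient.

(* i(delta), as an index type for the data attached to the subquotient *)
Definition divisible_index (n : nat) (d : 'I_n -> nat) (delta : nat) : finType :=
  {al : 'I_n | (delta %| d al)%N}.

(* Main.v *)
Require Import Defs.
From HB Require Import structures.
From mathcomp Require Import all_boot all_order all_algebra.
From mathcomp Require Import finmap mpoly.
From mathcomp Require Import boolp classical_sets functions reals.
From mathcomp Require Import complex.

Set Implicit Arguments.
Unset Strict Implicit.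
Unset Printing Implicit Defensive.

Import Order.TTheory GRing.Theory Num.Theory.

Local Open Scope fset_scope.
Local Open Scope ring_scope.

(** Put k = d1 / delta. In graded coordinates, z_al (g^k v) =
    zeta^(k (1 - d_al)) z_al v, and zeta^(k d_al) = 1 exactly when delta divides
    d_al; hence E is the common zero set of the z_al with delta not dividing
    d_al. Restricting a polynomial function to E therefore amounts to setting
    these variables to 0, which commutes with the partial derivatives in the
    remaining variables. As q lies in E, the conditions defining compatible and
    good invariants of the subquotient are among those for G, namely the ones
    for multi-orders extended by 0. *)

(** * Polynomials as functions over a field of characteristic 0 *)

Lemma mpoly_alg_ind (n : nat) (A : comNzRingType) (K : {mpoly A[n]} -> Prop) :
  (forall c, K c%:MP) -> (forall i, K 'X_i) ->
  (forall p q, K p -> K q -> K (p + q)) ->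
  (forall p q, K p -> K q -> K (p * q)) -> forall p, K p.
Proof.
move=> KC KX KD KM.
elim/mpolyind => [|c m p _ _ Kp]; first by rewrite -mpolyC0.
apply: KD => //; rewrite -mul_mpolyC; apply: (KM) => //.
rewrite mpolyXE_id; apply: (big_ind K) => [|p1 p2 K1 K2|i _].
- by rewrite -mpolyC1.
- exact: KM.
- elim: (m i) => [|k IH]; first by rewrite expr0 -mpolyC1.
  by rewrite exprS; apply: KM.
Qed.

(** A nonzero [p] has fewer than [size p] roots, whereas 0, 1, 2, ... are pairwise distinct in
    [C]. *)
Lemma poly_eval_eq0 (C : numDomainType) (p : {poly C}) :
  (forall t, p.[t] = 0) -> p = 0.
Proof.
move=> p0; apply/eqP/negPn/negP => /max_poly_roots max_p.
pose s := [seq i%:R : C | i <- iota 0 (size p)].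
suff : (size s < size p)%N by rewrite size_map size_iota ltnn.
apply: max_p; first by apply/allP => t _; apply/eqP.
by rewrite map_inj_uniq ?iota_uniq //; apply: mulrIn; exact: oner_neq0.
Qed.

(** Induction on the number of variables: [u] rewrites [p] as a polynomial in its last variable,
    with coefficients in the other [n] variables. *)
Lemma mpoly_eval_eq0 (C : numFieldType) (n : nat) (p : {mpoly C[n]}) :
  (forall w, p.@[w] = 0) -> p = 0.
Proof.
elim: n p => [|n IHn] p p0.
  suff pE : p = p.@[fun=> 0]%:MP by rewrite pE p0.
  elim/mpoly_alg_ind: {p0} p => [c|[]//|p r Kp Kr|p r Kp Kr].
  - by rewrite mevalC.
  - by rewrite mevalD mpolyCD -Kp -Kr.
  - by rewrite mevalM mpolyCM -Kp -Kr.
pose X (i : 'I_n.+1) : {poly {mpoly C[n]}} :=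
  if unlift ord_max i is Some j then ('X_j)%:P else 'X.
pose u := mmap (polyC \o @mpolyC n C) X.
have uD p1 p2 : u (p1 + p2) = u p1 + u p2 by exact: mmapD.
have uM p1 p2 : u (p1 * p2) = u p1 * u p2 by exact: rmorphM.
have uC c : u c%:MP = c%:MP%:P by rewrite /u mmapC.
have uX i : u 'X_i = X i by rewrite /u mmapX mmap1U.
clearbody u.
(* [u] is injective: widening the coefficients and putting the last variable back recovers [p]. *)
suff u0 : u p = 0.
  suff pE : p = (map_poly (@mwiden n C) (u p)).['X_ord_max].
    by rewrite pE u0 rmorph0 horner0.
  elim/mpoly_alg_ind: {p0 u0} p => [c|i|p r Kp Kr|p r Kp Kr].
  - by rewrite uC map_polyC hornerC /= mwidenC.
  - rewrite uX /X; case: unliftP => [j|] ->.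
      rewrite map_polyC hornerC /= mwidenX mnmwiden1; congr 'X_[U_(_)].
      by apply: val_inj; rewrite /= /bump leqNgt ltn_ord.
    by rewrite map_polyX hornerX.
  - by rewrite uD rmorphD hornerD -Kp -Kr.
  - by rewrite uM rmorphM hornerM -Kp -Kr.
(* It suffices that each coefficient of [u p] vanishes at every [w]; the one-variable case gives
   this, as [u p] specialised at [w] and evaluated at [t] is [p] at the point [w] completed by
   [t]. *)
apply/polyP => k; rewrite coef0; apply: IHn => w.
suff w0 : map_poly (meval w) (u p) = 0.
  by have := congr1 (fun r : {poly C} => r`_k) w0; rewrite coef_map coef0.
apply: poly_eval_eq0 => t.
have <- := p0 (fun i => if unlift ord_max i is Some j then w j else t).
elim/mpoly_alg_ind: {p0} p => [c|i|p r Kp Kr|p r Kp Kr].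
- by rewrite uC map_polyC hornerC /= !mevalC.
- rewrite uX /X mevalXU; case: unliftP => [j|] _.
    by rewrite map_polyC hornerC /= mevalXU.
  by rewrite map_polyX hornerX.
- by rewrite uD rmorphD hornerD Kp Kr mevalD.
- by rewrite uM rmorphM hornerM Kp Kr mevalM.
Qed.

(** * Polynomial functions as polynomials in linear coordinates *)

Section Subst.
Variables (C : numFieldType) (V : vectType C) (I : finType).
Implicit Types (y z : I -> polyfun V) (f : polyfun V).

Lemma subst_eval y (P : {mpoly C[#|I|]}) (v : V) :
  (subst y P : V -> C) v = P.@[fun i => y (enum_val i) v].
Proof.
elim/mpoly_alg_ind: P => [c|i|p r Kp Kr|p r Kp Kr].
- by rewrite /subst mmapC mevalC; exact: mulr1.
- by rewrite /subst mmapX mmap1U mevalXU.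
- by rewrite raddfD mevalD -Kp -Kr.
- by rewrite rmorphM mevalM -Kp -Kr.
Qed.

Lemma scalar_sum (l : V -> C) (J : finType) (c : J -> C) (v : J -> V) :
  scalar l -> l (\sum_j c j *: v j) = \sum_j c j * l (v j).
Proof.
move=> l_lin; have l0 : l 0 = 0.
  by have /eqP := l_lin 1 0 0; rewrite scaler0 addr0 mul1r -subr_eq subrr => /eqP.
by elim/big_rec2: _ => [|j c1 v1 _ <-]; rewrite ?l_lin.
Qed.

(** Every tuple of scalars is the coordinate tuple of some vector, so [P1 - P2] vanishes at all
    points. *)
Lemma subst_inj z : linear_coordinates z -> injective (subst z).
Proof.
move=> [_ [h _ hK]] P1 P2 P12; apply/subr0_eq/mpoly_eval_eq0 => w.
have wE i : z (enum_val i) (h [ffun al => w (enum_rank al)]) = w i :> C.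
  have /ffunP/(_ (enum_val i)) := hK [ffun al => w (enum_rank al)].
  by rewrite !ffunE enum_valK.
by rewrite mevalB -!(meval_eq _ wE) -!subst_eval P12 subrr.
Qed.

Lemma subst_surj z f : linear_coordinates z -> exists P, subst z P = f.
Proof.
move=> [z_lin [h zK hK]]; have /asboolP[p fE] := pf_prop f.
(* The basis of [V] dual to [z]; expanding [v] in it makes each standard coordinate a linear
   combination of the [z al]. *)
pose e al := h [ffun be => (be == al)%:R : C].
have z_e al be : z be (e al) = (be == al)%:R :> C.
  by have /ffunP/(_ be) := hK [ffun be => (be == al)%:R : C]; rewrite !ffunE.
have vE v : v = \sum_al (z al v : C) *: e al.
  apply: (can_inj zK); apply/ffunP => be; rewrite !ffunE (scalar_sum _ _ (z_lin be)).
  rewrite (bigD1 be) //= z_e eqxx mulr1 big1 ?addr0 // => al.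
  by rewrite z_e eq_sym => /negPf->; rewrite mulr0.
exists (p \mPo [tuple \sum_al stdcoord (e al) i *: 'X_(enum_rank al) | i < _]).
apply/val_inj/funext => v /=; rewrite subst_eval comp_mpoly_meval fE.
apply: meval_eq => i; rewrite tnth_mktuple {2}(vE v) /stdcoord linear_sum /=.
rewrite raddf_sum /=; apply: eq_bigr => al _.
by rewrite mevalZ mevalXU enum_rankK linearZ /= mulrC.
Qed.

Lemma expandK z : linear_coordinates z -> cancel (expand z) (subst z).
Proof.
by move=> zP f; exact: (@xgetPex _ 0 [set P | subst z P = f]%classic (subst_surj f zP)).
Qed.

Lemma substK z : linear_coordinates z -> cancel (subst z) (expand z).
Proof. by move=> zP P; apply: (subst_inj zP); rewrite expandK. Qed.

End Subst.

(** * Setting variables to 0, and its commutation with partial derivatives *)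

Lemma mderiv_mpolyXU (A : comNzRingType) (n : nat) (i k : 'I_n) :
  mderiv i 'X_k = (k == i)%:R%:MP :> {mpoly A[n]}.
Proof.
rewrite mderivX mnm1E; case: eqP => [->|_]; last by rewrite scale0r mpolyC0.
have -> : (U_(i) - U_(i) = 0 :> 'X_{1..n})%MM by apply/mnmP => l; rewrite mnmBE mnm0E subnn.
by rewrite mpolyX0 scale1r mpolyC1.
Qed.

Section RestrictVariables.
Variables (C : numFieldType) (I : finType) (S : pred I).
Let J : finType := {al : I | S al}.
Implicit Types (Q : {mpoly C[#|I|]}) (a : J -> nat).

(** The quotient map by the variables outside [S], transported through the enumerations of [I] and
    [J]: [insub] yields the index in [J], or nothing when the variable goes to 0. *)
Definition restrict_vars : {mpoly C[#|I|]} -> {mpoly C[#|J|]} :=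
  comp_mpoly
    [tuple oapp (fun j : J => 'X_(enum_rank j)) 0 (insub (enum_val i)) | i < #|I|].

Definition extend0 a : I -> nat := fun al => oapp a 0%N (insub al).

Lemma extend0_val a (j : J) : extend0 a (val j) = a j.
Proof. by rewrite /extend0 valK. Qed.

Lemma extend0_out a al : ~~ S al -> extend0 a al = 0%N.
Proof. by move=> Sal; rewrite /extend0 insubN. Qed.

(** With [c] the degrees this compares weighted degrees, and with [c] equal to 1 total orders; both
    occur in the definition of good invariants. *)
Lemma sum_extend0 a (c : I -> nat) :
  (\sum_al extend0 a al * c al = \sum_j a j * c (val j))%N.
Proof.
rewrite (bigID S) /= [X in (_ + X)%N]big1 ?addn0 => [|al Sal]; last first.
  by rewrite extend0_out.
rewrite (reindex_omap (val : J -> I) insub) /=; last first.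
  by move=> al Sal; rewrite insubT.
by apply: eq_big => [j|j _]; rewrite ?extend0_val // (valP j) valK eqxx.
Qed.

(** Both sides are additive and obey the same Leibniz rule, so variables and constants decide. A
    variable outside [S] goes to 0, and its derivative in a variable of [S] is already 0. *)
Lemma mderiv_restrict (i : 'I_#|J|) Q :
  mderiv i (restrict_vars Q) =
  restrict_vars (mderiv (enum_rank (val (enum_val i))) Q).
Proof.
rewrite /restrict_vars; elim/mpoly_alg_ind: Q => [c|k|p r Kp Kr|p r Kp Kr].
- by rewrite comp_mpolyC !mderivC rmorph0.
- rewrite comp_mpolyXU -tnth_nth tnth_mktuple mderiv_mpolyXU comp_mpolyC.
  case: insubP => /= [j _ jE|Sk]; last first.
    rewrite mderiv0 (_ : (k == _) = false) ?mpolyC0 //.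
    by apply/eqP => kE; move: Sk; rewrite kE enum_rankK (valP (enum_val i)).
  rewrite mderiv_mpolyXU; congr (_%:R%:MP : {mpoly C[_]}).
  rewrite (can2_eq (@enum_rankK _) (@enum_valK _)) -(inj_eq (@val_inj _ _ J)) /=.
  by rewrite jE (can2_eq (@enum_valK _) (@enum_rankK _)).
- by rewrite !(raddfD, mderivD) /= Kp Kr.
- by rewrite rmorphM !mderivM rmorphD !rmorphM /= Kp Kr.
Qed.

Lemma mderivm_restrict a Q :
  mderivm (mono a) (restrict_vars Q) =
  restrict_vars (mderivm (mono (extend0 a)) Q).
Proof.
(* The position in the enumeration of [I] of the [i]-th element of [J]. Both multi-orders become
   sums of unit ones matched by [s], and the derivatives are then moved across one at a time. *)
pose s (i : 'I_#|J|) := enum_rank (val (enum_val i)).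
have monoJ : mono a = (\sum_i U_(i) *+ a (enum_val i))%MM.
  apply/mnmP => k; rewrite mnmE mnm_sumE (bigD1 k) //= big1 ?addn0 => [|i i_k].
    by rewrite mulmnE mnm1E eqxx mul1n.
  by rewrite mulmnE mnm1E (negPf i_k).
have monoI : mono (extend0 a) = (\sum_i U_(s i) *+ a (enum_val i))%MM.
  apply/mnmP => k; rewrite mnmE mnm_sumE.
  transitivity (\sum_al extend0 a al * (al == enum_val k))%N.
    rewrite (bigD1 (enum_val k)) //= eqxx muln1 big1 ?addn0 // => al /negPf->.
    by rewrite muln0.
  rewrite sum_extend0 (reindex _ (onW_bij _ (@enum_val_bij J))).
  apply: eq_bigr => i _; rewrite mulmnE mnm1E mulnC; congr (_ * _)%N.
  by rewrite -(inj_eq enum_val_inj) enum_rankK.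
rewrite monoJ monoI; elim: (index_enum _) Q => [|i r IHr] Q.
  by rewrite !big_nil !mderivm0m.
rewrite !big_cons !mderivmDm -IHr; congr mderivm.
elim: (a _) => [|m IHm] in Q *; first by rewrite !mulm0n !mderivm0m.
by rewrite !mulmS !mderivmDm !mderivmU1m mderiv_restrict IHm.
Qed.

End RestrictVariables.

Lemma restrict_vars_eq0 (C : numFieldType) (I : finType) (S : pred I)
    (Q : {mpoly C[#|I|]}) :
  restrict_vars S Q = 0 ->
  exists H : I -> {mpoly C[#|I|]},
    Q = \sum_(al | ~~ S al) H al * 'X_(enum_rank al).
Proof.
pose J : finType := {al : I | S al}.
(* Both Q |-> Q and Q |-> widen (restrict_vars S Q) are ring morphisms, and their
   difference on each variable lies in the ideal. *)
pose widen : {mpoly C[#|J|]} -> {mpoly C[#|I|]} :=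
  comp_mpoly [tuple 'X_(enum_rank (val (enum_val i))) | i < #|J|].
suff [H HE] : exists H : I -> {mpoly C[#|I|]},
    Q - widen (restrict_vars S Q) = \sum_(al | ~~ S al) H al * 'X_(enum_rank al).
  by move=> Q0; exists H; rewrite -HE Q0 /widen comp_mpoly0 subr0.
elim/mpoly_alg_ind: Q => [c|i|p r [Hp pE] [Hr rE]|p r [Hp pE] [Hr rE]].
- exists (fun=> 0); rewrite /widen /restrict_vars !comp_mpolyC subrr big1 // => al _.
  exact: mul0r.
- exists (fun al => (al == enum_val i)%:R).
  rewrite /restrict_vars comp_mpolyXU -tnth_nth tnth_mktuple.
  case: insubP => [j Sj jE|Si] /=.
    rewrite /widen comp_mpolyXU -tnth_nth tnth_mktuple enum_rankK jE enum_valK subrr.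
    rewrite big1 // => al Sal; case: eqP => [alE|]; last by rewrite mul0r.
    by rewrite alE Sj in Sal.
  rewrite /widen comp_mpoly0 subr0 (bigD1 (enum_val i)) //= eqxx mul1r enum_valK.
  by rewrite big1 ?addr0 // => al /andP[_ /negPf->]; rewrite mul0r.
- exists (fun al => Hp al + Hr al).
  rewrite /restrict_vars /widen !comp_mpolyD opprD addrACA pE rE -big_split /=.
  by apply: eq_bigr => al _; rewrite mulrDl.
(* Writing p' and r' for the images, the witness comes from pr - p'r' = (p - p')r + p'(r - r'). *)
- exists (fun al => Hp al * r + widen (restrict_vars S p) * Hr al).
  have -> : \sum_(al | ~~ S al) (Hp al * r + widen (restrict_vars S p) * Hr al) *
              'X_(enum_rank al) =
            (p - widen (restrict_vars S p)) * r +
            widen (restrict_vars S p) * (r - widen (restrict_vars S r)).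
    rewrite pE rE mulr_suml mulr_sumr -big_split /=; apply: eq_bigr => al _.
    by rewrite mulrDl mulrAC mulrA.
  rewrite /restrict_vars /widen !rmorphM /=.
  by rewrite mulrBl mulrBr addrA subrK.
Qed.

(** * Homogeneity, and positivity of the degrees *)

Section Homogeneous.
Variable C : numFieldType.

Lemma comp_mpoly_homog (m n k : nat) (p : {mpoly C[m]}) (M : m.-tuple {mpoly C[n]}) :
  (forall i, tnth M i \is 1.-homog) -> p \is k.-homog -> p \mPo M \is k.-homog.
Proof.
move=> M1 /dhomogP p_k; rewrite comp_mpolyEX big_seq; apply: rpred_sum => l l_p.
rewrite rpredZ // comp_mpolyX -(p_k l l_p) /= mdegE.
apply: (big_ind2 (fun (e : {mpoly C[n]}) j => e \is j.-homog)) => [|????|i _].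
- exact: dhomog1.
- exact: dhomogM.
- by have := dhomogMn (l i) (M1 i); rewrite mul1n.
Qed.

Lemma homog_polyfun_pullback (U V : vectType C) (L : 'Hom(U, V)) (k : nat)
    (f : polyfun V) :
  homog_polyfun k f -> homog_polyfun k (pullback L f).
Proof.
case=> p p_k fp.
pose M i : {mpoly C[_]} := \sum_(j < \dim {:U})
   coord (vbasis {:V}) i (L (vbasis {:U})`_j) *: 'X_j.
exists (p \mPo [tuple M i | i < _]) => [|u].
  apply: comp_mpoly_homog p_k => i; rewrite tnth_mktuple; apply: rpred_sum => j _.
  by rewrite rpredZ // dhomogX /= mdeg1.
rewrite /= fp comp_mpoly_meval; apply: meval_eq => i.
rewrite !tnth_mktuple /M raddf_sum /stdcoord /=.
rewrite {1}(coord_vbasis (memvf u)) !linear_sum /=.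
by apply: eq_bigr => j _; rewrite !linearZ /= mevalXU mulrC.
Qed.

(** An invariant of degree 0 is a constant, so a variable and a constant polynomial would have the
    same image under the injective [subst x]. Positivity makes the truncated subtraction [d al - 1]
    a true one. *)
Lemma basic_invariants_degree_gt0 (V : vectType C) (G : {fset 'End(V)})
    (I : finType) (d : I -> nat) (x : I -> polyfun V) al :
  basic_invariants G d x -> (0 < d al)%N.
Proof.
case=> _ hx x_inj _; rewrite lt0n; apply/eqP => d0.
have [[p p_hom xE] _] := hx al; rewrite d0 in p_hom.
have pE : p = (p@_0)%:MP.
  apply/mpolyP => m; rewrite mcoeffC; case: eqP => [<-|/eqP m0]; first by rewrite mulr1.
  rewrite mulr0; apply: (dhomog_nemf_coeff p_hom).
  by rewrite /= mdeg_eq0.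
have /x_inj/(congr1 (mcoeff U_(enum_rank al))) :
    subst x 'X_(enum_rank al) = subst x ((p@_0)%:MP).
  apply/val_inj/funext => v /=; rewrite !subst_eval mevalXU enum_rankK xE {1}pE.
  by rewrite !mevalC.
rewrite mcoeffC mcoeffXU eqxx mnm1_eq0 mulr0 => /eqP; exact/negP/oner_neq0.
Qed.

End Homogeneous.

(** * Restriction of functions, endomorphisms and coordinates to a subspace *)

Section Restriction.
Variables (C : numFieldType) (V : vectType C) (E : {vspace V}).

Lemma phi_eval (f : polyfun V) (w : subvs_of E) : phi E f w = f (vsval w).
Proof. by rewrite /phi /= lfunE. Qed.

Lemma phi_surj (h : polyfun (subvs_of E)) : exists f, phi E f = h.
Proof.
exists (pullback (linfun (vsproj E)) h); apply/val_inj/funext => w /=.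
by rewrite !lfunE /= vsvalK.
Qed.

Lemma restr_eval (s : 'End(V)) (w : subvs_of E) :
  (s @: E <= E)%VS -> vsval (restr E s w) = s (vsval w).
Proof.
move=> sE; rewrite /restr !comp_lfunE !lfunE /= vsprojK //.
by apply: (subvP sE); rewrite memv_img ?subvsP.
Qed.

(** The restriction of [s] is injective, hence invertible on the finite-dimensional [E]; writing [w]
    as the image of its preimage cancels the inverse of [s]. *)
Lemma act_restr (s : 'End(V)) (f : polyfun V) :
  (s @: E <= E)%VS -> lker s = 0%VS -> act (restr E s) (phi E f) = phi E (act s f).
Proof.
move=> sE s0; apply/val_inj/funext => w; rewrite /act /= !lfunE /=.
have r0 : lker (restr E s) == 0%VS.
  apply/lker0P => u v /(congr1 (@vsval _ _ E)); rewrite !restr_eval // => suv.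
  by apply: subvs_inj; apply: (lker0P _ _ _ suv); rewrite s0.
rewrite -{2}[w](lker0_lfunVK r0) restr_eval // lker0_lfunK //; exact/eqP.
Qed.

(** Every element of the subquotient restricts some [s] in [G] preserving [E], so [act_restr]
    carries invariance over; a linear pullback keeps the degree. *)
Lemma homog_invariants_subquotient (G : {fset 'End(V)}) (I J : finType)
    (d : I -> nat) (x : I -> polyfun V) (j : J -> I) :
  finite_subgroup_GL G -> homog_invariants G d x ->
  homog_invariants (subquotient E G) (d \o j) (fun be => phi E (x (j be))).
Proof.
move=> [G0 _ _ _] hx be; have [x_hom x_inv] := hx (j be); split.
  exact: homog_polyfun_pullback.
move=> _ /imfsetP[s /= + ->]; rewrite !inE /= => /andP[sG sE].
by rewrite act_restr ?x_inv ?G0.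
Qed.

Section Coordinates.
Variables (I : finType) (S : pred I) (z : I -> polyfun V).
Let J : finType := {al : I | S al}.
Let zJ (j : J) : polyfun (subvs_of E) := phi E (z (val j)).
Hypothesis z_coord : linear_coordinates z.
Hypothesis z_E : forall v, v \in E <-> forall al, ~~ S al -> z al v = 0 :> C.

Lemma phi_coord_eq0 al : ~~ S al -> phi E (z al) = 0.
Proof.
move=> Sal; apply/val_inj/funext => w; rewrite [LHS]phi_eval.
by apply: (z_E _).1 => //; apply: subvsP.
Qed.

Lemma linear_coordinates_restrict : linear_coordinates zJ.
Proof.
have [z_lin [h zK hK]] := z_coord; split.
  by move=> j c u v; rewrite !phi_eval linearP; apply: z_lin.
(* Inverse of the restricted coordinates: the vector whose coordinates are [c] extended by 0, which
   lies in [E] by [z_E]. *)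
pose ext (c : {ffun J -> C}) := [ffun al => oapp c 0 (insub al)].
have h_ext c : h (ext c) \in E.
  apply/z_E => al Sal; have /ffunP/(_ al) := hK (ext c).
  by rewrite !ffunE insubN.
exists (fun c => vsproj E (h (ext c))) => [w|c].
  suff -> : ext [ffun j => zJ j w : C] = [ffun al => z al (vsval w) : C].
    by rewrite zK vsvalK.
  apply/ffunP => al; rewrite !ffunE; case: insubP => /= [j _ <-|Sal].
    by rewrite ffunE /= lfunE.
  by apply/esym; apply: (z_E _).1 => //; apply: subvsP.
apply/ffunP => j; rewrite ffunE /zJ phi_eval vsprojK //.
by have /ffunP/(_ (val j)) := hK (ext c); rewrite !ffunE valK.
Qed.

Lemma phi_subst Q : phi E (subst z Q) = subst zJ (restrict_vars S Q).
Proof.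
apply/val_inj/funext => w; rewrite [LHS]phi_eval /= !subst_eval comp_mpoly_meval.
apply: meval_eq => i; rewrite tnth_mktuple; case: insubP => [j _ jE|Si] /=.
  by rewrite mevalXU enum_rankK /= lfunE -jE.
by rewrite [RHS]meval0; apply: (z_E _).1 => //; apply: subvsP.
Qed.

(** The restricted coordinates are algebraically independent on [E], so the kernel of restriction is
    that of [restrict_vars], the ideal of the variables outside [S]. *)
Lemma phi_subst_eq0 Q :
  phi E (subst z Q) = 0 <->
  exists H : I -> {mpoly C[#|I|]},
    Q = \sum_(al | ~~ S al) H al * 'X_(enum_rank al).
Proof.
split=> [Q0|[H ->]].
  apply: restrict_vars_eq0; apply: (subst_inj linear_coordinates_restrict).
  by rewrite -phi_subst Q0 rmorph0.
rewrite (raddf_sum (subst z)) (raddf_sum (phi E)) big1 // => al Sal.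
have zX : subst z 'X_(enum_rank al) = z al by rewrite /subst mmapX mmap1U enum_rankK.
have HX : subst z (H al * 'X_(enum_rank al)) = subst z (H al) * z al.
  by rewrite -[in RHS]zX; exact: rmorphM.
by apply: etrans (congr1 (phi E) HX) _; rewrite rmorphM [X in _ * X]phi_coord_eq0 ?mulr0.
Qed.

(** Once [f] is expanded in [z], restriction is [restrict_vars] on the expansion, and
    [mderivm_restrict] applies. *)
Lemma pderiv_phi (a : J -> nat) (f : polyfun V) :
  pderiv zJ a (phi E f) = phi E (pderiv z (extend0 a) f).
Proof.
rewrite /pderiv -{1}(expandK z_coord f) phi_subst substK.
  by rewrite mderivm_restrict phi_subst.
exact: linear_coordinates_restrict.
Qed.

End Coordinates.
End Restriction.

(** * The eigenspace as a coordinate subspace *)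

Section Eigenspace.
Variables (C : numFieldType) (V : vectType C) (I : finType) (d : I -> nat).
Variables (g : 'End(V)) (zeta : C) (z : I -> polyfun V).
Hypothesis g_inj : lker g = 0%VS.
Hypothesis z_graded : graded d g zeta z.

Lemma mem_leigenspace (s : 'End(V)) (a : C) (v : V) :
  (v \in passmx.leigenspace s a) = (s v == a *: v).
Proof. by rewrite memv_ker !lfun_simp subr_eq0. Qed.

(** As [act g] composes with the inverse of [g], placing the power of [g] on the right keeps all
    exponents natural. *)
Lemma graded_lpow al k v :
  z al v = zeta ^+ ((d al - 1) * k) * z al (lpow g k v) :> C.
Proof.
elim: k v => [|k IHk] v; first by rewrite muln0 mul1r lfunE.
rewrite mulnS addnC exprD -mulrA /lpow iterS comp_lfunE.
have /(congr1 (fun f : polyfun V => (f : V -> C) (g (lpow g k v)))) := z_graded.2 al.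
by rewrite /act /= lker0_lfunK ?g_inj // => zE; rewrite (IHk v) zE.
Qed.

Lemma graded_eigenspace (d1 delta : nat) (v : V) :
  d1.-primitive_root zeta -> (delta %| d1)%N -> (forall al, 0 < d al)%N ->
  v \in passmx.leigenspace (lpow g (d1 %/ delta)) (zeta ^+ (d1 %/ delta)) <->
  forall al, ~~ (delta %| d al)%N -> z al v = 0 :> C.
Proof.
move=> zeta_prim delta_d1 d_gt0; set k := (d1 %/ delta)%N.
have d1_gt0 := prim_order_gt0 zeta_prim.
have k_gt0 : (0 < k)%N by rewrite /k (divn_gt0 _ (dvdn_gt0 d1_gt0 delta_d1)); apply: dvdn_leq.
have zeta0 : zeta != 0 by rewrite (prim_root_eq0 zeta_prim) -lt0n.
(* [zeta] has order [d1 = delta * k], and the factor [k] cancels in the divisibility. *)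
have zetaX al : (zeta ^+ (d al * k) == 1) = (delta %| d al)%N.
  by rewrite -(prim_order_dvd zeta_prim) -(divnK delta_d1) mulnC dvdn_pmul2r.
have zetaXE al : zeta ^+ ((d al - 1) * k) * zeta ^+ k = zeta ^+ (d al * k).
  by rewrite -exprD mulnBl mul1n subnK // leq_pmull.
have [z_lin [h zK _]] := z_graded.1; rewrite mem_leigenspace.
have zZ al c u : z al (c *: u) = c * z al u :> C.
  have z0 : z al 0 = 0 :> C.
    by have := z_lin al (-1) 0 0; rewrite scaler0 addr0 mulN1r addNr.
  by rewrite -[c *: u]addr0 z_lin z0 addr0.
split=> [/eqP gv al Sal|zv0].
  have := graded_lpow al k v; rewrite gv zZ mulrA zetaXE => /eqP.
  rewrite -{1}[z al v : C]mul1r -subr_eq0 -mulrBl mulf_eq0 subr_eq0 eq_sym zetaX.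
  by rewrite (negPf Sal) => /eqP.
apply/eqP/(can_inj zK)/ffunP => al; rewrite !ffunE zZ.
have := graded_lpow al k v; have [Sal|Sal] := boolP (delta %| d al)%N => zE.
  by rewrite zE mulrA [_ * zeta ^+ _]mulrC zetaXE (eqP (etrans (zetaX al) Sal)) mul1r.
rewrite (zv0 al Sal) mulr0; move/esym/eqP: zE.
by rewrite (zv0 al Sal) mulf_eq0 expf_eq0 (negPf zeta0) andbF => /eqP.
Qed.


End Eigenspace.

(** * The restriction statements for an admissible triplet *)

Theorem theorem3p1 (R : realType) (V : vectType R[i]) (n : nat)
    (dimV : \dim {:V} = n) (G : {fset 'End(V)}) (G_refl : reflection_group G)
    (d : 'I_n -> nat) (G_deg : degrees G d)
    (ds : 'I_n -> int) (G_codeg : codegrees G ds)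
    (d1 : nat) (d1E : d1 = \max_(al < n) d al)
    (eq_ab : #|[set al | (d1 %| d al)%N]| = #|[set al | (d1%:Z %| ds al)%Z]|)
    (g : 'End(V)) (zeta : R[i]) (q : V) (adm : admissible G d1 g zeta q)
    (delta : nat) (delta_gt1 : (1 < delta)%N) (delta_dvd : (delta %| d1)%N)
    (E : {vspace V})
    (EE : E = passmx.leigenspace (lpow g (d1 %/ delta)) (zeta ^+ (d1 %/ delta))) :
  let J := divisible_index d delta in
  let dJ := fun al : J => d (val al) in
  let phiJ := fun (y : 'I_n -> polyfun V) (al : J) => phi E (y (val al)) in
  let Gd := subquotient E G in
  let gE := restr E g in
  let qE := vsproj E q in
  [/\ [/\ g \in stab E G & q \in E],
      forall z : 'I_n -> polyfun V, graded d g zeta z ->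
        [/\ forall al, ~~ (delta %| d al)%N -> phi E (z al) = 0,
            graded dJ gE zeta (phiJ z)
          & [/\ bijective (subst z),
                forall f : polyfun (subvs_of E), exists P, phi E (subst z P) = f
              & forall P, phi E (subst z P) = 0 <->
                  exists Q : 'I_n -> {mpoly R[i][#|'I_n|]},
                    P = \sum_(al < n | ~~ (delta %| d al)%N)
                          Q al * 'X_(enum_rank al)]],
      forall x z : 'I_n -> polyfun V,
        basic_invariants G d x -> graded d g zeta z -> compatible z q x ->
        homog_invariants Gd dJ (phiJ x) /\ compatible (phiJ z) qE (phiJ x)
    & forall x : 'I_n -> polyfun V,
        basic_invariants G d x -> good d g zeta q x ->
        homog_invariants Gd dJ (phiJ x) /\ good dJ gE zeta qE (phiJ x)].
Proof.
move=> J dJ phiJ Gd gE qE.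
have [G_fin _] := G_refl; have [G0 _ _ _] := G_fin.
have [zeta_prim [gG _] _ gq] := adm; have g0 : lker g = 0%VS by exact: G0.
have d_gt0 al : (0 < d al)%N.
  by have [_ [y /(@basic_invariants_degree_gt0 _ _ _ _ _ _ al)]] := G_deg.
have lpow_g k v : lpow g k (g v) = g (lpow g k v).
  elim: k => [|k IHk]; first by rewrite !lfunE.
  by rewrite /lpow iterS !comp_lfunE -/(lpow g k) IHk.
have lpow_q k : lpow g k q = zeta ^+ k *: q.
  elim: k => [|k IHk]; first by rewrite lfunE scale1r.
  by rewrite /lpow iterS comp_lfunE -/(lpow g k) IHk linearZ /= gq scalerA -exprSr.
have qE' : q \in E by rewrite EE mem_leigenspace lpow_q.
(* [g] commutes with its powers, hence preserves their eigenspaces. *)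
have g_stab : g \in stab E G.
  rewrite !inE /= gG; apply/subvP => _ /memv_imgP[v + ->].
  by rewrite EE !mem_leigenspace lpow_g => /eqP->; rewrite linearZ.
have gE_sub : (g @: E <= E)%VS by move: g_stab; rewrite !inE => /andP[].
pose S (al : 'I_n) := (delta %| d al)%N.
have E_zero z : graded d g zeta z ->
    forall v, v \in E <-> forall al, ~~ S al -> z al v = 0 :> R[i].
  by move=> z_gr v; rewrite EE; apply: (graded_eigenspace g0 z_gr).
have phi_graded z : graded d g zeta z -> graded dJ gE zeta (phiJ z).
  move=> z_gr; split; first exact: (linear_coordinates_restrict z_gr.1 (E_zero z z_gr)).
  by move=> al; rewrite /phiJ /gE act_restr // z_gr.2 linearZ.
have phi_pderiv z (a : J -> nat) f : graded d g zeta z ->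
    pderiv (phiJ z) a (phi E f) qE = pderiv z (extend0 a) f q.
  move=> z_gr; rewrite /phiJ (pderiv_phi z_gr.1 (E_zero z z_gr)) phi_eval.
  by rewrite /qE vsprojK.
have phi_invariants x : basic_invariants G d x -> homog_invariants Gd dJ (phiJ x).
  by case=> _ hx _ _; apply: homog_invariants_subquotient.
split=> //.
- move=> z z_gr; split=> [al|//|].
  + exact: phi_coord_eq0 (E_zero z z_gr) _.
  + exact: phi_graded.
  + split.
    * by exists (expand z); [apply: substK|apply: expandK]; case: z_gr.
    * move=> f; have [f' <-] := phi_surj f.
      by exists (expand z f'); rewrite expandK //; case: z_gr.
    * by move=> P; apply: (phi_subst_eq0 z_gr.1 (E_zero z z_gr)).
- move=> x z x_basic z_gr x_comp; split; first exact: phi_invariants.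
  move=> al be; rewrite phi_pderiv //.
  (* A first-order derivative on [E] is one on [V]: a unit multi-order extended by 0 is again a unit
     one. *)
  have -> : extend0 (fun ga : J => (ga == be) : nat) = (fun ga => (ga == val be) : nat).
    apply/funext => ga; rewrite /extend0; case: insubP => [j _ <-|Sga] /=.
      by rewrite (inj_eq val_inj).
    by case: eqP => // gaE; rewrite gaE (valP be) in Sga.
  by rewrite x_comp (inj_eq val_inj).
- move=> x x_basic [z z_gr z_good]; split; first exact: phi_invariants.
  exists (phiJ z) => [|al a a_deg a_ge2]; first exact: phi_graded.
  rewrite phi_pderiv // z_good //; first by rewrite sum_extend0.
  (* The total order is the weighted sum with all weights 1, so it too is unchanged by extension. *)
  rewrite (eq_bigr (fun al => extend0 a al * 1)%N) => [|? _]; last by rewrite muln1.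
  by rewrite sum_extend0; under eq_bigr do rewrite muln1.
Qed.
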